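(* Let $\mu>0$ be fixed. If $f\in C^2([0,1])$, then for every $x\in[0,1]$ $$\lim_{n\to+\infty} n\left[\mathscr{L}_n(f,x)-f(x)\right]=\ln_\mu(x)\,\frac{x-x^2}{2}\left[\frac{f_\mu'(x)}{1+\mu}+f_\mu''(x)\right].$$
   Context: Fix a real parameter $\mu>0$. Put $\ln_\mu(x):=\ln(1+\mu+x)$ for $x\in[0,1]$, and for $n\in\mathbb{N}$, $n\ge 1$, and $0\le k\le n$ put $p_{n,k}(y):=\binom{n}{k}y^k(1-y)^{n-k}$ and $$a_n(x):=\frac{\ln\left(1+\frac{x}{n(1+\mu)}\right)}{\ln\left(1+\frac{1}{n(1+\mu)}\right)},\qquad x\in[0,1].$$ For a bounded function $f:[0,1]\to\mathbb{R}$, define $$\mathscr{L}_n f(x)=\mathscr{L}_n(f,x):=\ln_\mu(x)\sum_{k=0}^n \frac{f(k/n)}{\ln_\mu(k/n)}\,p_{n,k}(a_n(x)),\qquad x\in[0,1],$$ and $f_\mu(x):=f(x)/\ln_\mu(x)$. *)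

(* Defs.v *)
From HB Require Import structures.
From mathcomp Require Import all_boot all_order all_algebra.
From mathcomp Require Import all_classical all_reals all_analysis.

Set Implicit Arguments.
Unset Strict Implicit.
Unset Printing Implicit Defensive.

Import Order.TTheory GRing.Theory Num.Theory.
Import numFieldNormedType.Exports.

Local Open Scope classical_set_scope.
Local Open Scope ring_scope.

(* A function on [0, 1] is represented by a total function R -> R; the notions
   below, used with A = `[0, 1] and x in [0, 1], depend only on its values on
   [0, 1]. *)

(* Filter of the difference quotients of f at x whose second point stays in A:
   at an endpoint of an interval this gives the one-sided derivative. *)
Definition diff_quot_in (R : realType) (A : set R) (f : R -> R) (x : R) :
    set_system R :=
  (f y - f x) / (y - x) @[y --> within A x^'].

Definition derivable_in (R : realType) (A : set R) (f : R -> R) (x : R) : Prop :=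
  cvg (diff_quot_in A f x).

(* Meaningful only when [derivable_in A f x]. *)
Definition derive_in (R : realType) (A : set R) (f : R -> R) (x : R) : R :=
  lim (diff_quot_in A f x).

Definition C2_on (R : realType) (A : set R) (f : R -> R) : Prop :=
  [/\ forall x, A x -> derivable_in A f x,
      forall x, A x -> derivable_in A (derive_in A f) x &
      {within A, continuous (derive_in A (derive_in A f))}].

Definition ln_mu (R : realType) (mu x : R) : R := ln (1 + mu + x).

Definition bernstein (R : realType) (n k : nat) (y : R) : R :=
  'C(n, k)%:R * y ^+ k * (1 - y) ^+ (n - k).

(* Only n >= 1 matters; at n = 0 the divisions by zero return 0. *)
Definition a_ (R : realType) (mu : R) (n : nat) (x : R) : R :=
  ln (1 + x / (n%:R * (1 + mu))) / ln (1 + 1 / (n%:R * (1 + mu))).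

Definition L_ (R : realType) (mu : R) (n : nat) (f : R -> R) (x : R) : R :=
  ln_mu mu x *
  \sum_(k < n.+1) f (k%:R / n%:R) / ln_mu mu (k%:R / n%:R)
                  * bernstein n k (a_ mu n x).

Definition f_mu (R : realType) (mu : R) (f : R -> R) (x : R) : R :=
  f x / ln_mu mu x.

(* Main.v *)
Require Import Defs.
From mathcomp Require Import all_boot all_order all_algebra.
From mathcomp Require Import all_classical all_reals all_analysis.
From mathcomp Require Import ring lra.
Import Order.TTheory GRing.Theory Num.Theory.
Import numFieldNormedType.Exports.
Local Open Scope classical_set_scope.
Local Open Scope ring_scope.

(* With [g := f_mu mu f], [L_ mu n f x - f x] is [ln_mu mu x] times [B_n g (a_n x) - g x], where
   [B_n] is the Bernstein operator.  Expanding [g] to second order at [x], the remainder is at most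
   [e * (t - x) ^+ 2 + C * (t - x) ^+ 4] on the whole of [0, 1] for every [e > 0].  After
   multiplication by [n], the second moment about [x] of the binomial nodes tends to [x * (1 - x)]
   and the fourth tends to [0]; the first tends to [lim n * (a_n x - x)], which the second order
   expansion of [ln (1 + u)] at [u = 0] shows to be [(x - x ^+ 2) / (2 * (1 + mu))]. *)

(** * Calculus of derivatives relative to a set *)

Section OneSidedDerivatives.
Context {R : realType}.
Implicit Types (A : set R) (f g : R -> R) (x d e df dg : R).

(** Clearing the denominator makes the estimate trivial at [y = x], so the punctured filter becomes
    a bound on whole balls of [A], with no division left. *)
Lemma diff_quot_inP A f x d :
  diff_quot_in A f x --> d <->
  forall e : R, 0 < e -> exists2 r : R, 0 < r &
    forall y, A y -> `|y - x| < r ->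
      `|f y - f x - d * (y - x)| <= e * `|y - x|.
Proof.
have quotE y : y != x ->
    `|f y - f x - d * (y - x)| = `|d - (f y - f x) / (y - x)| * `|y - x|.
  rewrite -subr_eq0 => yx; rewrite -normrM mulrBl divfK// distrC.
  by [].
split.
  move=> /cvgrPdist_le fd e e0; have := fd _ e0.
  rewrite !near_withinE => /nbhs_ballP[r /= r0 fr].
  exists r => // y Ay yr; have [->|yx] := eqVneq y x.
    by rewrite !subrr mulr0 subr0 normr0 mulr0.
  rewrite quotE// ler_wpM2r//; apply: fr => //.
  by rewrite /ball/= distrC.
move=> fd; apply/cvgrPdist_le => e e0; have [r r0 fr] := fd _ e0.
rewrite !near_withinE; apply/nbhs_ballP; exists r => //= y.
rewrite /ball/= distrC => yr yx Ay; have := fr _ Ay yr.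
by rewrite quotE// ler_pM2r// normr_gt0 subr_eq0.
Qed.

(** Brings the two-sided derivative to the same form as [diff_quot_inP], so that passing between the
    two notions only means restricting [y] or shrinking the radius. *)
Lemma is_deriveP f x d :
  is_derive x 1 f d <->
  forall e : R, 0 < e -> exists2 r : R, 0 < r &
    forall y, `|y - x| < r -> `|f y - f x - d * (y - x)| <= e * `|y - x|.
Proof.
have quotE h : h != 0 ->
    `|f (h + x) - f x - d * h| =
    `|d - h^-1 *: (f (h *: 1 + x) - f x)| * `|h|.
  move=> h0; rewrite -normrM distrC; congr `|_|.
  by rewrite [h *: 1]mulr1 [h^-1 *: _]mulrC mulrBl divfK.
split=> [[/cvg_ex[l fl] dfl] e e0|fd].
  have ld : l = d by rewrite -dfl; exact/esym/(cvg_lim _ fl).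
  move/cvgrPdist_le : fl => /(_ _ e0).
  rewrite ld near_withinE => /nbhs_ballP[r /= r0 fr].
  exists r => // y yr; have [->|yx] := eqVneq y x.
    by rewrite !subrr mulr0 subr0 normr0 mulr0.
  rewrite -{1}(subrK x y) quotE ?subr_eq0// ler_wpM2r//; apply: fr => //=.
    by rewrite /ball/= sub0r normrN.
  by rewrite subr_eq0.
have fl : h^-1 *: ((f \o shift x) (h *: 1) - f x) @[h --> 0^'] --> d.
  apply/cvgrPdist_le => e e0; have [r r0 fr] := fd _ e0.
  rewrite near_withinE; apply/nbhs_ballP; exists r => //= h.
  rewrite /ball/= sub0r normrN => hr h0; have := fr (h + x).
  by rewrite addrK => /(_ hr); rewrite quotE// ler_pM2r// normr_gt0.
split; first by apply/cvg_ex; exists d.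
exact/cvg_lim.
Qed.

Lemma is_derive_diff_quot_in A f x d :
  is_derive x 1 f d -> diff_quot_in A f x --> d.
Proof.
move=> /is_deriveP fd; apply/diff_quot_inP => e e0.
by have [r r0 fr] := fd _ e0; exists r => // y _; exact: fr.
Qed.

Lemma diff_quot_in_is_derive A f x d :
  nbhs x A -> diff_quot_in A f x --> d -> is_derive x 1 f d.
Proof.
move=> /nbhs_ballP[s /= s0 sA] /diff_quot_inP fd.
apply/is_deriveP => e e0; have [r r0 fr] := fd _ e0.
exists (Num.min r s); first by rewrite lt_min r0.
move=> y; rewrite lt_min => /andP[yr ys]; apply: fr => //; apply: sA.
by rewrite /ball/= distrC.
Qed.

(** Serves to iterate [derive_in]: a closed formula for a first derivative is known only on [A], and
    can be differentiated in its place. *)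
Lemma eq_diff_quot_in A f g x d : A x -> {in A, f =1 g} ->
  diff_quot_in A f x --> d -> diff_quot_in A g x --> d.
Proof.
move=> Ax fg /diff_quot_inP fd; apply/diff_quot_inP => e e0.
have [r r0 fr] := fd _ e0; exists r => // y Ay yr.
by rewrite -!fg ?inE//; exact: fr.
Qed.

Lemma diff_quot_in_continuous A f x d :
  diff_quot_in A f x --> d -> f y @[y --> within A (nbhs x)] --> f x.
Proof.
move=> /diff_quot_inP/(_ 1 ltr01)[r r0 fr]; apply/cvgrPdist_le => e e0.
have d1 : 0 < 1 + `|d| by rewrite ltr_pwDl.
rewrite near_withinE; apply/nbhs_ballP.
exists (Num.min r (e / (1 + `|d|))) => /=; first by rewrite lt_min r0 divr_gt0.
move=> y; rewrite /ball/= lt_min distrC => /andP[yr ye] Ay.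
have := fr _ Ay yr; rewrite mul1r => fy.
rewrite distrC -[f y - _](subrK (d * (y - x))) (le_trans (ler_normD _ _))// normrM.
apply: le_trans (lerD fy (lexx _)) _.
by rewrite -{1}[`|y - x|]mul1r -mulrDl mulrC -ler_pdivlMr// ltW.
Qed.

Lemma diff_quot_inD A f g x df dg :
  diff_quot_in A f x --> df -> diff_quot_in A g x --> dg ->
  diff_quot_in A (fun y => f y + g y) x --> df + dg.
Proof.
move=> fd gd; rewrite /diff_quot_in.
under eq_fun do rewrite opprD addrACA mulrDl.
exact: cvgD.
Qed.

Lemma diff_quot_inM A f g x df dg :
  diff_quot_in A f x --> df -> diff_quot_in A g x --> dg ->
  diff_quot_in A (fun y => f y * g y) x --> df * g x + f x * dg.
Proof.
move=> fd gd; rewrite /diff_quot_in.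
have -> : (fun y => (f y * g y - f x * g x) / (y - x)) =
          (fun y => (f y - f x) / (y - x) * g y +
                    f x * ((g y - g x) / (y - x))).
  by apply/funext => y; ring.
apply: cvgD; last by apply: cvgM gd; exact: cvg_cst.
(* Continuity of [g] along [A] gives the limit of the factor [g y]; it remains to pass to the finer
   filter that excludes [x]. *)
apply: cvgM => //; apply: cvg_trans (diff_quot_in_continuous A g x dg gd).
apply: cvg_app => P AP.
have AP' : nbhs x (fun y => A y -> P y) := AP.
by apply: (filterS _ AP') => y AyP _.
Qed.

End OneSidedDerivatives.

(** * Second-order Taylor expansion on a segment, endpoints included *)

Section TaylorPeano.
Context {R : realType}.
Context (a b : R) (ab : a < b).
Implicit Types (f g : R -> R) (x d : R).

(** Properness makes limits of difference quotients unique, so that [derive_in] can be computed. A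
    point near [x] is found on its right if [x < b], on its left otherwise. *)
Lemma dnbhs_itv_proper x : x \in `[a, b] -> ProperFilter (within `[a, b] x^').
Proof.
rewrite in_itv/= => /andP[ax xb]; apply: Build_ProperFilter_ex => P.
move=> /nbhs_ballP[r /= r0 xP].
have [y yab [yx yr]] : exists2 y : R, y \in `[a, b] & y != x /\ `|x - y| < r.
  have [xb'|bx] := ltP x b.
    have [d [d0 dr db]] : exists d : R, [/\ 0 < d, d < r & x + d <= b].
      exists (Num.min (r / 2) (b - x)); split.
      - by rewrite lt_min divr_gt0// subr_gt0.
      - by rewrite gt_min ltr_pdivrMr// ltr_pMr// ltr1n.
      - by rewrite -lerBrDl ge_min lexx orbT.
    exists (x + d); first by rewrite /= in_itv/= db (le_trans ax)// lerDl ltW.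
    split; first by rewrite gt_eqF// ltrDl.
    by rewrite opprD addrA subrr sub0r normrN gtr0_norm.
  have [d [d0 dr da]] : exists d : R, [/\ 0 < d, d < r & a <= x - d].
    exists (Num.min (r / 2) (x - a)); split.
    - by rewrite lt_min divr_gt0// subr_gt0 (lt_le_trans ab).
    - by rewrite gt_min ltr_pdivrMr// ltr_pMr// ltr1n.
    - by rewrite lerBrDr -lerBrDl ge_min lexx orbT.
  exists (x - d); first by rewrite /= in_itv/= da (le_trans _ xb)// gerBl ltW.
  split; first by rewrite lt_eqF// gtrBl.
  by rewrite opprB addrC subrK gtr0_norm.
by exists y; apply: xP.
Qed.

Lemma derive_inE f x d : x \in `[a, b] ->
  diff_quot_in `[a, b] f x --> d -> derive_in `[a, b] f x = d.
Proof.
move=> xab; have pf := dnbhs_itv_proper x xab.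
exact: cvg_lim.
Qed.

Lemma derivable_in_bounded f : (forall x, x \in `[a, b] -> derivable_in `[a, b] f x) ->
  exists M : R, forall x, x \in `[a, b] -> `|f x| <= M.
Proof.
move=> df; have fc : {within `[a, b], continuous f}.
  apply/subspace_continuousP => x /df/cvg_ex[d]; exact: diff_quot_in_continuous.
have /compact_bounded[M [_ fM]] := continuous_compact fc (@segment_compact _ a b).
exists (M + 1) => x xab; apply: (fM (M + 1)); first by rewrite ltrDl.
by exists x.
Qed.

(** By the mean value theorem the remainder is [dh c * (y - x)] with [c] between [x] and [y], and
    differentiability of [df] at the single point [x] gives [dh c = o(c - x)]. *)
Lemma taylor2_peano f (df : R -> R) (d2f x : R) : x \in `[a, b] ->
  (forall y, y \in `[a, b] -> diff_quot_in `[a, b] f y --> df y) ->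
  diff_quot_in `[a, b] df x --> d2f ->
  forall e : R, 0 < e -> exists2 r : R, 0 < r &
    forall y, y \in `[a, b] -> `|y - x| < r ->
      `|f y - f x - df x * (y - x) - d2f / 2 * (y - x) ^+ 2| <= e * (y - x) ^+ 2.
Proof.
move=> xab fdf /diff_quot_inP df2 e e0; have [r r0 fr] := df2 _ e0.
exists r => // y yab yr.
pose h t := f t - df x * t - d2f / 2 * (t - x) ^+ 2.
pose dh t := df t - df x - d2f * (t - x).
have hE : f y - f x - df x * (y - x) - d2f / 2 * (y - x) ^+ 2 = h y - h x.
  by rewrite /h; ring.
have hdh t : t \in `[a, b] -> diff_quot_in `[a, b] h t --> dh t.
  (* Only [f] needs the relative derivative; the polynomial part has an ordinary one. *)
  move=> tab; have -> : h = fun s => f s + (- df x * s - d2f / 2 * (s - x) ^+ 2).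
    by apply/funext => s; rewrite /h; ring.
  rewrite /dh -addrA; apply: diff_quot_inD; first exact: fdf.
  apply: is_derive_diff_quot_in; apply: is_derive_eq; rewrite /GRing.scale/=.
  by field.
(* Two-sided differentiability is required only inside []u, v[], a neighbourhood contained in
   [[a, b]]; at [u] and [v] continuity within the segment suffices. *)
have MVTh u v : a <= u -> u < v -> v <= b ->
    exists2 c, u < c < v & h v - h u = dh c * (v - u).
  move=> au uv vb; have [] := @MVT _ h dh u v uv.
  - move=> c cuv; apply: (diff_quot_in_is_derive `[a, b]); last first.
      apply: hdh; move: cuv; rewrite /= !in_itv/= => /andP[uc cv].
      by rewrite (le_trans au (ltW uc)) (le_trans (ltW cv)).
    apply: (filterS _ (near_in_itvoo cuv)) => t /=; rewrite !in_itv/=.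
    by move=> /andP[ut tv]; rewrite (le_trans au (ltW ut)) (le_trans (ltW tv)).
  - apply: (@continuous_subspaceW _ _ _ `[a, b]).
      by move=> t /=; rewrite !in_itv/= => /andP[ut tv]; rewrite (le_trans au)// (le_trans tv).
    apply/subspace_continuousP => t /hdh; exact: diff_quot_in_continuous.
  by move=> c; rewrite in_itv/= => cuv hc; exists c.
have hb c : c \in `[a, b] -> `|c - x| <= `|y - x| ->
    `|dh c * (y - x)| <= e * (y - x) ^+ 2.
  move=> cab cy; rewrite normrM -real_normK ?num_real// expr2 mulrA ler_wpM2r//.
  apply: le_trans (fr _ cab (le_lt_trans cy yr)) _.
  by rewrite ler_wpM2l// ltW.
move: xab yab; rewrite !in_itv/= => /andP[ax xb] /andP[ay yb].
rewrite hE; have [yx|xy|->] := ltgtP y x; last first.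
- by rewrite !subrr normr0 expr0n mulr0.
- have [c /andP[xc cy] ->] := MVTh x y ax xy yb.
  apply: hb; first by rewrite in_itv/= (le_trans ax (ltW xc)) (le_trans (ltW cy)).
  by rewrite !gtr0_norm ?subr_gt0// lerB// ltW.
- have [c /andP[yc cx] hc] := MVTh y x ay yx xb.
  have -> : h y - h x = dh c * (y - x) by rewrite -opprB hc; ring.
  apply: hb; first by rewrite in_itv/= (le_trans ay (ltW yc)) (le_trans (ltW cx)).
  by rewrite !ltr0_norm ?subr_lt0// lerN2 lerB// ltW.
Qed.

(* Away from [x] the remainder is bounded, hence dominated by a multiple of [(y - x) ^+ 4]. *)
Lemma taylor2_quartic f (df : R -> R) (d2f x : R) : x \in `[a, b] ->
  (forall y, y \in `[a, b] -> diff_quot_in `[a, b] f y --> df y) ->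
  diff_quot_in `[a, b] df x --> d2f ->
  forall e : R, 0 < e -> exists2 C : R, 0 <= C &
    forall y, y \in `[a, b] ->
      `|f y - f x - df x * (y - x) - d2f / 2 * (y - x) ^+ 2| <=
      e * (y - x) ^+ 2 + C * (y - x) ^+ 4.
Proof.
move=> xab fdf df2 e e0; have [r r0 fr] := taylor2_peano f df d2f x xab fdf df2 e e0.
set h := fun y => f y - f x - df x * (y - x) - d2f / 2 * (y - x) ^+ 2.
have [M fM] : exists M : R, forall y, y \in `[a, b] -> `|f y| <= M.
  by apply: derivable_in_bounded => y yab; apply/cvg_ex; exists (df y); exact: fdf.
pose K := M + M + `|df x| * (b - a) + `|d2f / 2| * (b - a) ^+ 2.
have ba0 : 0 <= b - a by rewrite subr_ge0 ltW.
have hK y : y \in `[a, b] -> `|h y| <= K.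
  move=> yab; have yx : `|y - x| <= b - a.
    move: xab yab; rewrite !in_itv/= ler_norml => /andP[? ?] /andP[? ?].
    by apply/andP; split; lra.
  rewrite /h /K; apply: le_trans (ler_normB _ _) _; apply: lerD; last first.
    by rewrite normrM normrX ler_wpM2l// lerXn2r ?nnegrE.
  apply: le_trans (ler_normB _ _) _; apply: lerD; last by rewrite normrM ler_wpM2l.
  by apply: le_trans (ler_normB _ _) _; apply: lerD; exact: fM.
have K0 : 0 <= K by apply: le_trans (hK _ xab).
(* When [r <= |y - x|], the factor [(y - x) ^+ 4 / r ^+ 4] is at least 1, so the quartic term alone
   exceeds the global bound [K]. *)
exists (K / r ^+ 4); first by rewrite divr_ge0// exprn_ge0// ltW.
move=> y yab; rewrite -/(h y); have [yr|ry] := ltP `|y - x| r.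
  apply: le_trans (fr y yab yr) _.
  by rewrite lerDl mulr_ge0// ?divr_ge0 ?exprn_even_ge0// exprn_ge0// ltW.
apply: le_trans (hK y yab) _; rewrite ler_wpDl//.
  by rewrite mulr_ge0 ?sqr_ge0// ltW.
rewrite -mulrA ler_peMr// mulrC ler_pdivlMr ?exprn_gt0// mul1r.
rewrite -[leRHS]ger0_norm ?exprn_even_ge0// normrX lerXn2r ?nnegrE//.
exact: ltW.
Qed.

End TaylorPeano.

(** * Moments of the binomial distribution *)

Section BernsteinMoments.
Context {R : realType}.
Implicit Types (phi psi : R -> R) (y : R).

Definition binomial_mean (n : nat) y phi : R :=
  \sum_(k < n.+1) phi k%:R * bernstein n k y.

Lemma bernsteinS n k y :
  bernstein n.+1 k.+1 y = y * bernstein n k y + (1 - y) * bernstein n k.+1 y.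
Proof.
(* Pascal's rule. Truncated subtraction makes [n - k = (n - k.+1).+1] valid only for [k < n];
   otherwise ['C(n, k.+1)] vanishes. *)
rewrite /bernstein binS natrD subSS exprS.
have [kn|nk] := ltnP k n; first by rewrite -(subnSK kn) exprS; ring.
by rewrite bin_small ?ltnS//; ring.
Qed.

(** Conditioning on one Bernoulli trial: with weight [y] it succeeds and raises the count by one,
    with weight [1 - y] the count is unchanged. *)
Lemma binomial_meanS n y phi :
  binomial_mean n.+1 y phi =
  y * binomial_mean n y (fun t => phi (t + 1)) + (1 - y) * binomial_mean n y phi.
Proof.
rewrite /binomial_mean big_ord_recl/=.
under eq_bigr do rewrite /bump/= add1n bernsteinS mulrDr.
rewrite big_split/= addrCA; congr (_ + _).
  rewrite big_distrr/=; apply: eq_bigr => k _.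
  by rewrite -natr1; ring.
(* The top term of the failure sum carries ['C(n, n.+1) = 0]; the remaining terms, with the isolated
   [k = 0] term, rebuild the mean of [phi]. *)
rewrite big_ord_recr/= [X in _ + (_ + X)](_ : _ = 0) ?addr0; last first.
  by rewrite /bernstein bin_small//; ring.
rewrite big_ord_recl/= mulrDr; congr (_ + _).
  by rewrite /bernstein !bin0 !expr0 !subn0 exprS; ring.
by rewrite big_distrr/=; apply: eq_bigr => k _; rewrite /bump/= add1n; ring.
Qed.

Lemma binomial_meanD n y phi psi :
  binomial_mean n y (fun t => phi t + psi t) =
  binomial_mean n y phi + binomial_mean n y psi.
Proof. by rewrite -big_split; apply: eq_bigr => k _; rewrite mulrDl. Qed.

Lemma binomial_meanZ n y c phi :
  binomial_mean n y (fun t => c * phi t) = c * binomial_mean n y phi.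
Proof. by rewrite big_distrr; apply: eq_bigr => k _; rewrite -mulrA. Qed.

Lemma eq_binomial_mean n y phi psi : (forall k, (k <= n)%N -> phi k%:R = psi k%:R) ->
  binomial_mean n y phi = binomial_mean n y psi.
Proof. by move=> e; apply: eq_bigr => k _; rewrite e// -ltnS. Qed.

Lemma bernstein_ge0 n k y : 0 <= y <= 1 -> 0 <= bernstein n k y.
Proof.
move=> /andP[y0 y1]; rewrite /bernstein !mulr_ge0 ?exprn_ge0 ?ler0n//.
by rewrite subr_ge0.
Qed.

Lemma ler_norm_binomial_mean n y phi psi : 0 <= y <= 1 ->
  (forall k, (k <= n)%N -> `|phi k%:R| <= psi k%:R) ->
  `|binomial_mean n y phi| <= binomial_mean n y psi.
Proof.
move=> y01 pp; apply: le_trans (ler_norm_sum _ _ _) _; apply: ler_sum => k _.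
have b0 := bernstein_ge0 n k y y01.
by rewrite normrM (ger0_norm b0) ler_wpM2r// pp// -ltnS.
Qed.

(* The recursion of binomial_meanS shifts the centre [n y] by [y], so the moments are
   taken about an arbitrary point to make the induction go through. *)
Lemma binomial_moments n y c :
  [/\ binomial_mean n y (fun=> 1) = 1,
      binomial_mean n y (fun t => t - c) = n%:R * y - c,
      binomial_mean n y (fun t => (t - c) ^+ 2) =
        (n%:R * y - c) ^+ 2 + n%:R * (y * (1 - y)) &
      binomial_mean n y (fun t => (t - c) ^+ 4) =
        (n%:R * y - c) ^+ 4 + 6 * (n%:R * y - c) ^+ 2 * (n%:R * (y * (1 - y)))
        + 4 * (n%:R * y - c) * (n%:R * (y * (1 - y)) * (1 - 2 * y))
        + n%:R * (y * (1 - y)) * (1 + 3 * (n%:R - 2) * (y * (1 - y)))].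
Proof.
elim: n c => [|n IH] c.
  rewrite /binomial_mean !big_ord1 /bernstein /= bin0 !expr0 mulr1.
  by split; ring.
have [m0 m1 m2 m4] := IH c; have [_ s1 s2 s4] := IH (c - 1).
have shift j : binomial_mean n y (fun t => (t + 1 - c) ^+ j) =
               binomial_mean n y (fun t => (t - (c - 1)) ^+ j).
  by apply: eq_binomial_mean => k _; congr (_ ^+ _); ring.
have shift1 : binomial_mean n y (fun t => t + 1 - c) =
              binomial_mean n y (fun t => t - (c - 1)).
  by apply: eq_binomial_mean => k _; ring.
rewrite !binomial_meanS !shift shift1 m0 m1 m2 m4 s1 s2 s4 -natr1.
by split; ring.
Qed.

End BernsteinMoments.

(** * Limits of sequences *)

Lemma near_eq_cvg_lim {R : realType} (f g : R^nat) (l l' : R) :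
  (\forall n \near \oo, f n = g n) -> l = l' ->
  f n @[n --> \oo] --> l -> g n @[n --> \oo] --> l'.
Proof. by move=> fg -> fl; apply: cvg_trans (near_eq_cvg fg) fl. Qed.

Lemma cvg_inv_nat {R : realType} : (n%:R^-1 : R) @[n --> \oo] --> (0 : R).
Proof.
apply/gtr0_cvgV0; last exact: cvgr_idn.
by near=> n; rewrite ltr0n; near: n; exact: nbhs_infty_gt.
Unshelve. all: by end_near. Qed.

(** * Voronovskaya asymptotics at nodes [y n] with [n * (y n - x)] convergent *)

Section Voronovskaya.
Context {R : realType}.
Context (x b : R) (y : R^nat) (yx : n%:R * (y n - x) @[n --> \oo] --> b).

Let i : R^nat := fun n => n%:R^-1.
Let d : R^nat := fun n => n%:R * (y n - x).
Let v : R^nat := fun n => y n * (1 - y n).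

Let cvg_i : i n @[n --> \oo] --> 0.
Proof. exact: cvg_inv_nat. Qed.

Lemma perturbed_node_cvg : y n @[n --> \oo] --> x.
Proof.
have yE : \forall n \near \oo, x + d n * i n = y n.
  near=> n; rewrite /d /i; field; rewrite pnatr_eq0 -lt0n.
  by near: n; exact: nbhs_infty_gt.
apply: (near_eq_cvg_lim _ _ (x + b * 0) _ yE); first by ring.
by apply: cvgD; [exact: cvg_cst|exact: cvgM].
Unshelve. all: by end_near. Qed.

Let cvg_v : v n @[n --> \oo] --> x * (1 - x).
Proof.
by apply: cvgM; [|apply: cvgB; [exact: cvg_cst|]]; exact: perturbed_node_cvg.
Qed.

Let scaled_moment n j : (0 < n)%N ->
  binomial_mean n (y n) (fun t => (t / n%:R - x) ^+ j) =
  i n ^+ j * binomial_mean n (y n) (fun t => (t - n%:R * x) ^+ j).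
Proof.
move=> n0; rewrite -binomial_meanZ; apply: eq_binomial_mean => k _.
by rewrite -exprMn /i; congr (_ ^+ _); field; rewrite pnatr_eq0 -lt0n.
Qed.

Let moment2 n := n%:R * binomial_mean n (y n) (fun t => (t / n%:R - x) ^+ 2).
Let moment4 n := n%:R * binomial_mean n (y n) (fun t => (t / n%:R - x) ^+ 4).

Let cvg_moment2 : moment2 n @[n --> \oo] --> x * (1 - x).
Proof.
have mE : \forall n \near \oo, d n * d n * i n + v n = moment2 n.
  near=> n; have n0 : (0 < n)%N by near: n; exact: nbhs_infty_gt.
  rewrite /moment2 scaled_moment//.
  have [_ _ -> _] := binomial_moments n (y n) (n%:R * x).
  by rewrite /d /i /v; field; rewrite pnatr_eq0 -lt0n.
apply: (near_eq_cvg_lim _ _ (b * b * 0 + x * (1 - x)) _ mE); first by ring.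
by apply: cvgD; [apply: cvgM; [exact: cvgM|]|].
Unshelve. all: by end_near. Qed.

Let cvg_moment4 : moment4 n @[n --> \oo] --> 0.
Proof.
(* [w n] collects the coefficient of [n ^- 2] in [moment4 n]; the other terms have orders [n ^- 3]
   and [n ^- 1], so convergence of [w] is enough. *)
pose w n := 6 * d n * d n * v n + 4 * d n * v n * (1 - 2 * y n) + v n - 6 * v n * v n.
have mE : \forall n \near \oo,
    d n * d n * d n * d n * i n * i n * i n + w n * i n * i n + 3 * v n * v n * i n =
    moment4 n.
  near=> n; have n0 : (0 < n)%N by near: n; exact: nbhs_infty_gt.
  rewrite /moment4 scaled_moment//.
  have [_ _ _ ->] := binomial_moments n (y n) (n%:R * x).
  by rewrite /w /d /i /v; field; rewrite pnatr_eq0 -lt0n.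
have cd : d n @[n --> \oo] --> b := yx.
have cw : cvg (w n @[n --> \oo]).
  pose vx := x * (1 - x).
  apply/cvg_ex; exists (6 * b * b * vx + 4 * b * vx * (1 - 2 * x) + vx - 6 * vx * vx).
  have cy := perturbed_node_cvg.
  by do ?[exact: cvg_cst|exact: cd|exact: cvg_v|exact: cy|apply: cvgD|apply: cvgN|apply: cvgM].
apply: (near_eq_cvg_lim _ _ (b * b * b * b * 0 * 0 * 0 + lim (w n @[n --> \oo]) * 0 * 0
  + 3 * (x * (1 - x)) * (x * (1 - x)) * 0) _ mE); first by ring.
by do ?[exact: cvg_cst|exact: cw|exact: cd|exact: cvg_i|exact: cvg_v|apply: cvgD|apply: cvgM].
Unshelve. all: by end_near. Qed.

Context (y01 : forall n, 0 <= y n <= 1) (x01 : x \in `[0, 1]).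

(** The drift [b] of the nodes adds [dg x * b]; for [y n = x] this is the classical formula for
    Bernstein polynomials. *)
Lemma bernstein_voronovskaya (g dg : R -> R) (d2g : R) :
  (forall t, t \in `[0, 1] -> diff_quot_in `[0, 1] g t --> dg t) ->
  diff_quot_in `[0, 1] dg x --> d2g ->
  n%:R * (binomial_mean n (y n) (fun t => g (t / n%:R)) - g x) @[n --> \oo] -->
    dg x * b + d2g / 2 * (x * (1 - x)).
Proof.
move=> gdg d2.
pose h t := g t - g x - dg x * (t - x) - d2g / 2 * (t - x) ^+ 2.
pose r n := n%:R * binomial_mean n (y n) (fun t => h (t / n%:R)).
have gE : \forall n \near \oo, dg x * d n + d2g / 2 * moment2 n + r n =
    n%:R * (binomial_mean n (y n) (fun t => g (t / n%:R)) - g x).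
  near=> n; have n0 : (0 < n)%N by near: n; exact: nbhs_infty_gt.
  (* The exponent 1 lets [scaled_moment] treat the first moment as well. *)
  have -> : binomial_mean n (y n) (fun t => g (t / n%:R)) =
      binomial_mean n (y n) (fun t => h (t / n%:R)) +
      (g x * binomial_mean n (y n) (fun=> 1) +
      (dg x * binomial_mean n (y n) (fun t => (t / n%:R - x) ^+ 1) +
      d2g / 2 * binomial_mean n (y n) (fun t => (t / n%:R - x) ^+ 2))).
    rewrite -!binomial_meanZ -!binomial_meanD.
    by apply: eq_binomial_mean => k _; rewrite /h; ring.
  rewrite (scaled_moment n 1)//.
  have [-> -> _ _] := binomial_moments n (y n) (n%:R * x).
  by rewrite /r /moment2 /d /i; field; rewrite pnatr_eq0 -lt0n.
apply: (near_eq_cvg_lim _ _ (dg x * b + d2g / 2 * (x * (1 - x)) + 0) _ gE).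
  by rewrite addr0.
apply: cvgD.
  by apply: cvgD; apply: cvgM; [exact: cvg_cst|exact: yx|exact: cvg_cst|exact: cvg_moment2].
apply/cvgr0Pnorm_le => e e0; have e20 : 0 < e / 2 by rewrite divr_gt0.
have [C C0 hC] := taylor2_quartic 0 1 ltr01 g dg d2g x x01 gdg d2 (e / 2) e20.
(* The limit of [moment2] lies strictly below 1, so eventually [moment2 n <= 1] and the quadratic
   part of the remainder costs at most [e / 2]. *)
have xx : x * (1 - x) < 1.
  by have := sqr_ge0 (x - 1 / 2); lra.
have cC : C * moment4 n @[n --> \oo] --> 0.
  have : C * moment4 n @[n --> \oo] --> C * 0 by apply: cvgM => //; exact: cvg_cst.
  by rewrite mulr0.
near=> n; have n0 : (0 < n)%N by near: n; exact: nbhs_infty_gt.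
have m2 : moment2 n <= 1 by apply/ltW; near: n; exact: (cvgr_lt _ cvg_moment2).
have m4 : C * moment4 n <= e / 2 by apply/ltW; near: n; exact: (cvgr_lt _ cC).
apply: (@le_trans _ _ (e / 2 * moment2 n + C * moment4 n)); last first.
  by rewrite [leRHS]splitr lerD// ler_piMr// ltW.
rewrite /r /moment2 /moment4 normrM ger0_norm// !(mulrCA _ n%:R) -mulrDr ler_wpM2l//.
rewrite -!binomial_meanZ -binomial_meanD; apply: ler_norm_binomial_mean => // k kn.
apply: hC; rewrite in_itv/= divr_ge0//= ler_pdivrMr ?ltr0n// mul1r ler_nat.
exact: kn.
Unshelve. all: by end_near. Qed.

End Voronovskaya.

(** * The nodes [a_ mu n x] and their drift *)

Section LogarithmicNodes.
Context {R : realType}.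
Implicit Types mu x t : R.

Lemma is_derive_ln_shift (c x : R) : 0 < c + x -> is_derive x 1 (fun y => ln (c + y)) (c + x)^-1.
Proof.
move=> cx; have D : is_derive x 1 (fun y => c + y) 1.
  by apply: is_derive_eq; rewrite add0r mulr1.
have := @is_derive1_comp _ (@ln R) (fun y => c + y) x _ _ (is_derive1_ln cx) D.
by rewrite mulr1.
Qed.

Lemma is_derive_inv_shift (c x : R) : c + x != 0 ->
  is_derive x 1 (fun y => (c + y)^-1) (- (c + x) ^- 2).
Proof.
move=> cx; have D : is_derive x 1 (fun y => c + y) 1.
  by apply: is_derive_eq; rewrite add0r mulr1.
by have := is_deriveV cx D; rewrite [_ *: _]mulr1.
Qed.

Lemma cvg_ln1p_second_order t : 0 <= t ->
  n%:R ^+ 2 * (ln (1 + t / n%:R) - t / n%:R) @[n --> \oo] --> - (t ^+ 2 / 2).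
Proof.
move=> t0; apply/cvgrPdist_le => e e0.
have i0 : t / n%:R @[n --> \oo] --> t * 0.
  by apply: cvgM; [exact: cvg_cst|exact: cvg_inv_nat].
have t2 : 0 < t ^+ 2 + 1 by rewrite ltr_wpDl// sqr_ge0.
have zero01 : (0 : R) \in `[0, 1] by rewrite in_itv/= lexx ler01.
(* The remainder at [t / n], multiplied by [n ^+ 2], is at most the tolerance times [t ^+ 2], hence
   the choice [e / (t ^+ 2 + 1)]; the added 1 covers [t = 0]. *)
have [||r r0 hr] := taylor2_peano 0 1 (fun y => ln (1 + y))
    (fun y => (1 + y)^-1) (-1) 0 zero01 _ _ (e / (t ^+ 2 + 1)) (divr_gt0 e0 t2).
- move=> y; rewrite in_itv/= => /andP[y0 _].
  by apply/is_derive_diff_quot_in/is_derive_ln_shift; rewrite ltr_wpDr.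
- apply: is_derive_diff_quot_in; have := @is_derive_inv_shift 1 0.
  by rewrite addr0 expr1n invr1; apply; exact: oner_neq0.
near=> n; have n0 : 0 < n%:R :> R by rewrite ltr0n; near: n; exact: nbhs_infty_gt.
have tn0 : 0 <= t / n%:R by rewrite divr_ge0// ltW.
have tn1 : t / n%:R <= 1.
  by apply/ltW; near: n; apply: (cvgr_lt _ i0); rewrite mulr0.
have tnr : t / n%:R < r.
  by near: n; apply: (cvgr_lt _ i0); rewrite mulr0.
have := hr (t / n%:R); rewrite in_itv/= tn0 tn1 subr0 addr0 ln1 invr1 ger0_norm//.
move=> /(_ isT tnr) H.
have -> : - (t ^+ 2 / 2) - n%:R ^+ 2 * (ln (1 + t / n%:R) - t / n%:R) =
    - (n%:R ^+ 2 * (ln (1 + t / n%:R) - 0 - 1 * (t / n%:R) - -1 / 2 * (t / n%:R) ^+ 2)).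
  by field; rewrite gt_eqF.
rewrite normrN normrM ger0_norm ?sqr_ge0//.
apply: le_trans (ler_wpM2l (sqr_ge0 _) H) _.
have -> : n%:R ^+ 2 * (e / (t ^+ 2 + 1) * (t / n%:R) ^+ 2) = e * (t ^+ 2 / (t ^+ 2 + 1)).
  by field; rewrite !gt_eqF.
by rewrite ler_piMr ?ler_pdivrMr ?mul1r ?lerDl// ltW.
Unshelve. all: by end_near. Qed.

Lemma a_itv mu n x : 0 < mu -> 0 <= x <= 1 -> 0 <= a_ mu n x <= 1.
Proof.
move=> mu0 /andP[x0 x1]; rewrite /a_.
set e := (n%:R * (1 + mu))^-1.
have e0 : 0 <= e by rewrite invr_ge0 mulr_ge0// addr_ge0// ltW.
have xe0 : 0 <= x * e by rewrite mulr_ge0.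
have lnx : 0 <= ln (1 + x * e) by rewrite ln_ge0// lerDl.
have lne : ln (1 + x * e) <= ln (1 + 1 * e).
  by rewrite ler_ln ?posrE ?ltr_wpDr ?mul1r// lerD2l ler_piMl.
(* The denominator vanishes only for [n = 0], where division by zero returns 0. *)
have := le_trans lnx lne; rewrite le_eqVlt => /orP[/eqP <-|lne0].
  by rewrite invr0 mulr0 lexx ler01.
apply/andP; split; first by rewrite divr_ge0// ltW.
by rewrite ler_pdivrMr// [leRHS]mul1r.
Qed.

(** The linear parts of the two logarithms cancel in [ln (1 + x * c / n) - x * ln (1 + c / n)];
    scaled by [n ^+ 2] this is [P n - x * Q n], while [n] times the denominator of [a_] is
    [c + Q n / n], which tends to [c]. *)
Lemma cvg_a_ mu x : 0 < mu -> 0 <= x ->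
  n%:R * (a_ mu n x - x) @[n --> \oo] --> (x - x ^+ 2) / (2 * (1 + mu)).
Proof.
move=> mu0 x0; pose c := (1 + mu)^-1.
have c0 : 0 < c by rewrite invr_gt0 addr_gt0.
pose P n : R := n%:R ^+ 2 * (ln (1 + x * c / n%:R) - x * c / n%:R).
pose Q n : R := n%:R ^+ 2 * (ln (1 + c / n%:R) - c / n%:R).
have cP : P n @[n --> \oo] --> - ((x * c) ^+ 2 / 2).
  by apply: cvg_ln1p_second_order; rewrite mulr_ge0// ltW.
have cQ : Q n @[n --> \oo] --> - (c ^+ 2 / 2) by apply: cvg_ln1p_second_order; exact: ltW.
have aE : \forall n \near \oo,
    (P n - x * Q n) * (c + Q n * n%:R^-1)^-1 = n%:R * (a_ mu n x - x).
  near=> n; have n0 : 0 < n%:R :> R by rewrite ltr0n; near: n; exact: nbhs_infty_gt.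
  have lne : 0 < ln (1 + c / n%:R) by rewrite ln_gt0// ltrDl divr_gt0.
  have -> : c + Q n * n%:R^-1 = n%:R * ln (1 + c / n%:R).
    by rewrite /Q; field; rewrite gt_eqF.
  have xcE : x / (n%:R * (1 + mu)) = x * c / n%:R by rewrite /c invfM mulrCA mulrA; ring.
  have cE : 1 / (n%:R * (1 + mu)) = c / n%:R by rewrite /c invfM; ring.
  rewrite /a_ xcE cE /P /Q; field.
  by rewrite !gt_eqF.
apply: (near_eq_cvg_lim _ _
  ((- ((x * c) ^+ 2 / 2) - x * - (c ^+ 2 / 2)) * (c + - (c ^+ 2 / 2) * 0)^-1) _ aE).
  by rewrite /c; field; rewrite gt_eqF// addr_gt0.
apply: cvgM; first by apply: cvgB => //; apply: cvgM => //; exact: cvg_cst.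
apply: cvgV; first by rewrite mulr0 addr0 gt_eqF.
by apply: cvgD; [exact: cvg_cst|apply: cvgM; [exact: cQ|exact: cvg_inv_nat]].
Unshelve. all: by end_near. Qed.

End LogarithmicNodes.

(** * Regularity of [f_mu mu f] and conclusion *)

Lemma f_mu_C2 (R : realType) (mu : R) (f : R -> R) : 0 < mu ->
  (forall x, x \in `[0, 1] -> derivable_in `[0, 1] f x) ->
  (forall x, x \in `[0, 1] -> derivable_in `[0, 1] (derive_in `[0, 1] f) x) ->
  forall x, x \in `[0, 1] -> derivable_in `[0, 1] (f_mu mu f) x /\
    derivable_in `[0, 1] (derive_in `[0, 1] (f_mu mu f)) x.
Proof.
move=> mu0 df d2f.
have pos (y : R) : y \in `[0, 1] -> 1 < 1 + mu + y.
  by rewrite in_itv/= => /andP[y0 _]; rewrite -addrA ltrDl ltr_wpDr.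
pose q y := (1 + mu + y)^-1; pose u y := (ln_mu mu y)^-1.
have dq y : y \in `[0, 1] -> diff_quot_in `[0, 1] q y --> - (1 + mu + y) ^- 2.
  move=> /pos y1; apply/is_derive_diff_quot_in/is_derive_inv_shift.
  by rewrite gt_eqF// (lt_trans ltr01).
(* The derivative of [u] is written as a product of [u] and [q], so the product rule alone yields
   the second derivative. *)
have du y : y \in `[0, 1] -> diff_quot_in `[0, 1] u y --> -1 * (u y * u y * q y).
  move=> /pos y1; apply: is_derive_diff_quot_in.
  have := @is_deriveV _ (ln_mu mu) y _ 1 _ (is_derive_ln_shift (1 + mu) y (lt_trans ltr01 y1)).
  have l0 : ln_mu mu y != 0 by rewrite gt_eqF// ln_gt0.
  move=> /(_ l0); congr is_derive.
  by rewrite /GRing.scale/= /u /q; field; rewrite l0 gt_eqF// (lt_trans ltr01).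
have dg y : y \in `[0, 1] -> diff_quot_in `[0, 1] (f_mu mu f) y -->
    derive_in `[0, 1] f y * u y + f y * (-1 * (u y * u y * q y)).
  by move=> y01; apply: diff_quot_inM; [exact: df|exact: du].
move=> x x01; split; first by apply/cvg_ex; eexists; exact: dg.
have dgE : {in `[0, 1]%classic,
    (fun y => derive_in `[0, 1] f y * u y + f y * (-1 * (u y * u y * q y)))
    =1 derive_in `[0, 1] (f_mu mu f)}.
  by move=> y; rewrite inE => y01; rewrite (derive_inE 0 1 ltr01 _ _ _ y01 (dg y y01)).
have d1 : diff_quot_in `[0, 1] (fun=> -1) x --> (0 : R).
  by apply: is_derive_diff_quot_in; exact: is_derive_cst.
apply/cvg_ex; eexists; apply: (eq_diff_quot_in _ _ _ _ _ _ dgE); first exact: x01.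
apply: diff_quot_inD; first by apply: diff_quot_inM; [exact: d2f|exact: du].
apply: diff_quot_inM; first exact: df.
apply: diff_quot_inM; first exact: d1.
apply: diff_quot_inM; last exact: dq.
by apply: diff_quot_inM; exact: du.
Qed.

Theorem theorem4p2 (R : realType) (mu : R) (hmu : 0 < mu) (f : R -> R)
    (hf : C2_on `[0, 1] f) (x : R) (hx : x \in `[0, 1]) :
  n%:R * (L_ mu n f x - f x) @[n --> \oo] -->
    ln_mu mu x * ((x - x ^+ 2) / 2) *
      (derive_in `[0, 1] (f_mu mu f) x / (1 + mu)
       + derive_in `[0, 1] (derive_in `[0, 1] (f_mu mu f)) x).
Proof.
have [df d2f _] := hf.
have gC2 := f_mu_C2 R mu f hmu df d2f.
have x01 : 0 <= x <= 1 by move: hx; rewrite in_itv.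
have /andP[x0 _] := x01.
have l0 : ln_mu mu x != 0.
  by rewrite gt_eqF// ln_gt0// -addrA ltrDl ltr_wpDr.
have V := bernstein_voronovskaya x _ _ (cvg_a_ mu x hmu x0)
  (fun n => a_itv mu n x hmu x01) hx (f_mu mu f)
  (derive_in `[0, 1] (f_mu mu f)) (derive_in `[0, 1] (derive_in `[0, 1] (f_mu mu f)) x)
  (fun t ht => (gC2 t ht).1) (gC2 x hx).2.
(* The sum in [L_] is by definition the binomial mean of [f_mu mu f], and [f x] is
   [ln_mu mu x * f_mu mu f x] because [ln_mu mu x] is nonzero. *)
have LE : \forall n \near \oo, ln_mu mu x *
    (n%:R * (binomial_mean n (a_ mu n x) (fun t => f_mu mu f (t / n%:R)) - f_mu mu f x)) =
    n%:R * (L_ mu n f x - f x).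
  apply: nearW => n; rewrite /L_ -/(binomial_mean n (a_ mu n x) (fun t => f_mu mu f (t / n%:R))).
  by rewrite {2}/f_mu; field.
apply: (near_eq_cvg_lim _ _ _ _ LE _ (cvgM (cvg_cst (ln_mu mu x)) V)).
by field; rewrite gt_eqF// addr_gt0.
Qed.
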